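(* Let $T(V,E,w)$ be a type-$1$ strictly convex tree. (1) The maximum weight $\max_{v\in V}w(v)$ is carried by at least one of the leaf vertices of $T$. (2) If in addition $T$ is rooted with root $\tilde v\in V$, and $w(\tilde v)\le w(u)$ for every vertex $u$ adjacent to $\tilde v$, then the root attains the minimum weight, i.e. $w(\tilde v)=\min_{v\in V}w(v)$.
   Context: All trees are finite. A weighted tree $T(V,E,w)$ is a tree with vertex set $V$ and edge set $E$ together with a weight function $w:V\to\mathbb{R}_+$, where $\mathbb{R}_+=[0,\infty)$. A leaf is a vertex of degree $1$ (in the degenerate case of a single-vertex tree, its unique vertex is considered a leaf); the other vertices, i.e. those of degree at least $2$, are internal. $T(V,E,w)$ is type-$1$ strictly convex if for every internal vertex $v$ and every two distinct vertices $v_1,v_2$ adjacent to $v$, one has $2w(v)<w(v_1)+w(v_2)$. *)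

(* Defs.v *)
From mathcomp Require Import all_boot all_order all_algebra.
From mathcomp Require Import reals.
Set Implicit Arguments.
Unset Strict Implicit.
Unset Printing Implicit Defensive.
Import Order.TTheory GRing.Theory Num.Theory.
Local Open Scope ring_scope.

(* A simple graph on V is given by its adjacency relation e.  The bound
   [size c <= 2] excludes genuine cycles only: since e is symmetric, every edge
   {x, y} already yields the [ucycle] [:: x; y]. *)
Definition is_tree (V : finType) (e : rel V) : Prop :=
  [/\ (0 < #|V|)%N, symmetric e, irreflexive e,
      forall x y : V, connect e x y
    & forall c : seq V, ucycle e c -> (size c <= 2)%N].

Definition degree (V : finType) (e : rel V) (v : V) : nat :=
  #|[set u | e v u]|.

(* The second disjunct is the convention for the single-vertex tree, whose
   vertex has degree 0. *)
Definition leaf (V : finType) (e : rel V) (v : V) : bool :=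
  (degree e v == 1)%N || (#|V| == 1)%N.

Definition internal (V : finType) (e : rel V) (v : V) : bool :=
  (2 <= degree e v)%N.

Definition type1_strictly_convex (R : realType) (V : finType) (e : rel V)
    (w : V -> R) : Prop :=
  forall v v1 v2 : V, internal e v -> e v v1 -> e v v2 -> v1 != v2 ->
    2 * w v < w v1 + w v2.

Definition attains_max (R : realType) (V : finType) (w : V -> R) (v : V) : Prop :=
  forall u : V, w u <= w v.

Definition attains_min (R : realType) (V : finType) (w : V -> R) (v : V) : Prop :=
  forall u : V, w v <= w u.

(* Main.v *)
Require Import Defs.
From mathcomp Require Import all_boot all_order all_algebra.
From mathcomp Require Import reals lra.
Import Order.TTheory GRing.Theory Num.Theory.
Local Open Scope ring_scope.

(** Both parts rest on reading the convexity inequality [2 w v < w v1 + w v2]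
    at a single internal vertex.

    For the maximum: the inequality says that some neighbour of [v] is heavier
    than [v], so a vertex of maximum weight has at most one neighbour
    ([argmax_not_internal]); by connectedness it is then a leaf
    ([not_internal_leaf]).

    For the minimum: rewritten as [w v - w v1 < w v2 - w v], the inequality
    says that the increments of [w] strictly increase along a simple path.  If
    the weight does not drop on the first step out of the root, it never drops
    afterwards ([path_weight_ge]), and every vertex is the end of a simple path
    from the root. *)

(** A vertex without neighbours can be connected to itself only, so in a
    connected graph degree [0] occurs only for the single-vertex graph. *)
Lemma not_internal_leaf (V : finType) (e : rel V) (v : V) :
  (forall x y : V, connect e x y) -> ~~ internal e v -> leaf e v.
Proof.
rewrite /internal /leaf -leqNgt leq_eqVlt ltnS leqn0 => conn.
case/orP => [-> // | /eqP deg0].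
apply/orP; right.
suff all_v x : x = v.
  by apply/fintype1P; exists v.
case/connectP: (conn v x) => [[|y p] /=]; first by [].
case/andP => evy _ _.
have := cards0_eq deg0 => /setP /(_ y).
by rewrite !inE evy.
Qed.

Lemma argmax_not_internal (R : realType) (V : finType) (e : rel V)
    (w : V -> R) (v : V) :
  type1_strictly_convex e w -> attains_max w v -> ~~ internal e v.
Proof.
move=> conv vmax; apply/negP => int_v.
have /card_gt1P [v1 [v2 [ev1 ev2 v12]]] := int_v.
move: ev1 ev2; rewrite !inE => ev1 ev2.
have := conv _ _ _ int_v ev1 ev2 v12.
by have := vmax v1; have := vmax v2; lra.
Qed.

(** The induction carries the first step [x, y] of the path rather than its
    start only, since convexity at [y] turns [w x <= w y] into the same
    inequality for the next step; uniqueness of the vertices makes the two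
    neighbours of [y] on the path distinct. *)
Lemma path_weight_ge (R : realType) (V : finType) (e : rel V) (w : V -> R)
    (x y : V) (p : seq V) :
  symmetric e -> type1_strictly_convex e w ->
  path e x (y :: p) -> uniq [:: x, y & p] -> w x <= w y ->
  w x <= w (last y p).
Proof.
move=> sym_e conv.
elim: p x y => [|z p IHp] x y //= /and3P [exy eyz pth] /and3P [x_out y_out uq].
move=> le_xy.
have eyx : e y x by rewrite sym_e.
have x_neq_z : x != z by move: x_out; rewrite !inE !negb_or => /and3P [].
have int_y : internal e y.
  by apply/card_gt1P; exists x, z; rewrite !inE.
have convy := conv _ _ _ int_y eyx eyz x_neq_z.
apply: (le_trans le_xy); apply: IHp; rewrite /= ?eyz ?y_out //.
by lra.
Qed.

Theorem proposition1p9 (R : realType) (V : finType) (e : rel V) (w : V -> R)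
    (treeT : is_tree e) (w_ge0 : forall v : V, 0 <= w v)
    (convexT : type1_strictly_convex e w) :
  (exists v : V, leaf e v /\ attains_max w v) /\
  (forall root : V, (forall u : V, e root u -> w root <= w u) ->
     attains_min w root).
Proof.
case: treeT => card_gt0 sym_e _ conn _; split.
  case/card_gt0P: card_gt0 => v0 _.
  case: (@arg_maxP _ _ _ v0 xpredT w isT) => v _ vmax.
  have v_max : attains_max w v by move=> u; exact: vmax.
  exists v; split=> //.
  exact: not_internal_leaf conn (argmax_not_internal _ _ _ _ _ convexT v_max).
move=> root root_le u.
case/connectP: (conn root u) => p pth ->.
case/shortenP: pth => -[|y q] //= pth uq _.
apply: (path_weight_ge _ _ e) => //.
by case/andP: pth => /root_le.
Qed.
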